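(* Let $r\geq 2$ and $n\geq 2r+1$ be integers, $\alpha:=\left\lfloor\frac{n+1}{r+1}\right\rfloor$, and let $I_j=\{(r+1)(j-1),\dots,(r+1)j-1\}$ for $j=1,\dots,\alpha$. Let $l,s_1,\dots,s_l$ be integers such that $0\leq s_j\leq r-1$ for $j=1,\dots,l$ and $0<l\leq\min\{\alpha,\,n-r-1-\sum_{i=1}^l s_i\}$. Then the linear projection $$\Pi_{T^{s_1,\dots,s_l}_{e_{I_1},\dots,e_{I_l}}}$$ of $\mathbb{G}(r,n)$ with center $\langle T^{s_1}_{e_{I_1}}\mathbb{G}(r,n),\dots,T^{s_l}_{e_{I_l}}\mathbb{G}(r,n)\rangle$ is birational (onto the closure of its image).
   Context: We work over $\mathbb{C}$. $\mathbb{G}(r,n)$ is the Grassmannian of $r$-planes in $\mathbb{P}^n$, embedded in $\mathbb{P}^N=\mathbb{P}(\bigwedge^{r+1}\mathbb{C}^{n+1})$ by the Plücker embedding. Let $e_0,\dots,e_n$ be the canonical basis of $\mathbb{C}^{n+1}$, and for $I=\{i_0<\dots<i_r\}\subset\{0,\dots,n\}$ let $e_I\in\mathbb{G}(r,n)$ be the point $[e_{i_0}\wedge\dots\wedge e_{i_r}]$. For a smooth point $p$ of a variety $X\subset\mathbb{P}^N$ with local parametrization $\phi$ near $p$ (in an affine chart, $\phi(0)=p$), the $s$-osculating space $T^s_pX$ is the projective closure of the affine subspace through $p$ with direction spanned by the partial derivatives of $\phi$ of order at most $s$ at $0$. *)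

(* Defs.v *)
From HB Require Import structures.
From mathcomp Require Import all_boot all_order all_algebra.
From mathcomp Require Import all_classical all_reals all_analysis.
From mathcomp Require Export complex.
From mathcomp Require mpoly.
(* The notations of mpoly clash with those of the analysis library. *)
Import -(notations) mpoly.

Set Implicit Arguments.
Unset Strict Implicit.
Unset Printing Implicit Defensive.

Import Order.TTheory GRing.Theory Num.Theory numFieldNormedType.Exports.
Local Open Scope classical_set_scope.
Local Open Scope ring_scope.

(* A point of the projective space P(K^N) is represented by its nonzero
   representatives in 'rV[K]_N, and a subset of P(K^N) by the set of all the
   nonzero representatives of its points. *)

Section ZariskiTopology.
Variables (K : fieldType) (N : nat).
Implicit Types (A U X Z : set 'rV[K]_N) (u v : 'rV[K]_N).

Definition same_point u v := u != 0 /\ exists2 c : K, c != 0 & u = c *: v.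

Definition homogeneous (d : nat) (f : mpoly N K) : Prop :=
  f \is ishomog1 d mdeg.

Definition evalp v (f : mpoly N K) : K := meval (v ord0) f.

Definition zariski_closed Z :=
  exists2 S : set (mpoly N K),
    forall f, S f -> exists d, homogeneous d f
    & Z = [set v | v != 0 /\ forall f, S f -> evalp v f = 0].

Definition zariski_closure A : set 'rV[K]_N :=
  [set v | forall Z, zariski_closed Z -> A `<=` Z -> Z v].

Definition dense_open_in X U :=
  (exists2 Z, zariski_closed Z & U = X `\` Z) /\ X `<=` zariski_closure U.

End ZariskiTopology.

Section RationalMaps.
Variable K : fieldType.

Definition homogeneous_map N M (f : 'rV[K]_N -> 'rV[K]_M) :=
  exists d (F : 'I_M -> mpoly N K),
    (forall i, homogeneous d (F i)) /\ (forall v, f v = \row_i evalp v (F i)).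

(* f represents a rational map from X to Y. *)
Definition rational_map N M (X : set 'rV[K]_N) (Y : set 'rV[K]_M)
    (f : 'rV[K]_N -> 'rV[K]_M) :=
  homogeneous_map f /\
  exists2 U, dense_open_in X U & forall x, U x -> f x != 0 /\ Y (f x).

Definition generically_id N (X : set 'rV[K]_N) (h : 'rV[K]_N -> 'rV[K]_N) :=
  exists2 U, dense_open_in X U & forall x, U x -> same_point (h x) x.

Definition birational_map N M (X : set 'rV[K]_N) (Y : set 'rV[K]_M)
    (f : 'rV[K]_N -> 'rV[K]_M) :=
  rational_map X Y f /\
  exists g : 'rV[K]_M -> 'rV[K]_N,
    [/\ rational_map Y X g, generically_id X (g \o f)
      & generically_id Y (f \o g)].

Definition image_closure N M (X : set 'rV[K]_N) (f : 'rV[K]_N -> 'rV[K]_M) :=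
  zariski_closure [set y | y != 0 /\ exists2 x, X x & y = f x].

(* The linear projection with center P(L) is induced by a surjective linear map
   with kernel L; it is unique up to a linear isomorphism of the target. *)
Definition linear_projection N M (L : {vspace 'rV[K]_N})
    (pi : 'Hom('rV[K]_N, 'rV[K]_M)) :=
  lker pi = L /\ limg pi = fullv.

End RationalMaps.

Section Osculating.
Variables (K : numFieldType) (N : nat).
Implicit Types (X : set 'rV[K]_N) (p : 'rV[K]_N).

Definition iter_partial d (a : seq 'I_d) (phi : 'rV[K]_d -> 'rV[K]_N) :
    'rV[K]_d -> 'rV[K]_N :=
  foldr (fun i f => 'D_(delta_mx ord0 i) f) phi a.

(* phi parametrizes, over an open neighbourhood U of 0, an open (for the
   classical topology) neighbourhood of p in X, in the affine chart x_k = 1.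
   Over the complex numbers lp_smooth says that phi is holomorphic on U. *)
Record local_parametrization X p d (k : 'I_N) (U : set 'rV[K]_d)
    (phi : 'rV[K]_d -> 'rV[K]_N) : Prop := LocalParametrization {
  lp_open : open U;
  lp_0 : U 0;
  lp_center : same_point (phi 0) p;
  lp_chart : forall t, U t -> X (phi t) /\ phi t ord0 k = 1;
  lp_smooth : forall (a : seq 'I_d) t, U t ->
    differentiable (iter_partial a phi) t;
  lp_immersion : forall t, U t -> row_free (jacobian phi t);
  lp_inj : {in U &, injective phi};
  lp_homeo : forall W, open W -> W `<=` U ->
    exists2 O : set 'rV[K]_N, open O
      & phi @` W = [set x | [/\ X x, x ord0 k = 1 & O x]]
}.

(* Linear span of phi 0 and of the partial derivatives of order 1, ..., s
   at 0. As phi is normalized by x_k = 1, these derivatives lie in the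
   hyperplane x_k = 0 of directions of the chart, and this span is the cone over
   the projective closure of the affine subspace through phi 0 that they
   direct. *)
Definition osculating_span d (phi : 'rV[K]_d -> 'rV[K]_N) (s : nat) :
    {vspace 'rV[K]_N} :=
  (\sum_(m < s.+1) \sum_(a : m.-tuple 'I_d) <[iter_partial a phi 0]>)%VS.

(* P(T) is the s-osculating space of X at p. *)
Definition osculating_space X p (s : nat) (T : {vspace 'rV[K]_N}) :=
  exists d k (U : set 'rV[K]_d) phi,
    local_parametrization X p k U phi /\ T = osculating_span phi s.

End Osculating.

Section Grassmannian.
Variables (K : fieldType) (r n : nat).

Definition plucker_index : {set {set 'I_n.+1}} :=
  [set J : {set 'I_n.+1} | #|J| == r.+1].

(* The coordinates on P(\wedge^(r+1) K^(n+1)) are indexed by 'I_plucker_dim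
   through enum_val : 'I_#|plucker_index| -> {set 'I_n.+1}. *)
Definition plucker_dim : nat := #|plucker_index|.

(* Coordinates of the wedge product of the rows of A; enum J is increasing. *)
Definition plucker (A : 'M[K]_(r.+1, n.+1)) : 'rV[K]_plucker_dim :=
  \row_k \det (\matrix_(i < r.+1, j < r.+1)
                 A i (nth ord0 (enum (enum_val k : {set 'I_n.+1})) j)).

(* Stable under nonzero scaling, as one may scale a single row of A. *)
Definition grassmannian : set 'rV[K]_plucker_dim :=
  [set plucker A | A in [set A | row_free A]].

Definition e_point (J : {set 'I_n.+1}) : 'rV[K]_plucker_dim :=
  \row_k ((enum_val k : {set 'I_n.+1}) == J)%:R.

Definition block (j : nat) : {set 'I_n.+1} :=
  [set i : 'I_n.+1 | (r.+1 * j <= i < r.+1 * j.+1)%N].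

End Grassmannian.

Arguments grassmannian K r n : clear implicits.
Arguments e_point K r {n} J.
Arguments block r n j : clear implicits.

(* Main.v *)
Require Import Defs.
From mathcomp Require Import all_boot all_order all_algebra.
From mathcomp Require Import all_classical all_reals all_analysis.
From mathcomp Require Import complex perm zify.
From mathcomp Require mpoly.
Import -(notations) mpoly.

(**
  Only the inclusion of [T^s_{e_I}] in the span of the [e_J] with
  [#|J :\: I| <= s] is needed. It holds because in the chart [x_I = 1] the
  Pluecker relations write [x_J] as a sum of products of [#|J :\: I|] functions
  vanishing at [e_I]. Hence the projection of [x] determines [x_J] for every [J]
  that meets each block [I_j] in at most [r - s_j] elements ([within_cap] below).

  The numerical hypothesis says that some set [k |: G0] with [r + 2] elements
  satisfies this bound. On the open set where the minors [G0] and [G0 - i + k]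
  do not vanish, the matrix of an [r]-plane in the basis of the columns [G0] is a
  rational function of such [x_J]: column [j] is read off the minors
  [G0 - i + j] if the block of [j] is not saturated by [G0]; otherwise some [g] in
  [G0] lies in the same block, and column [j] is obtained in the basis
  [G0 - g + k], column [k] being already known. This gives a homogeneous
  polynomial inverse. The identities hold on a nonempty open set, hence
  everywhere by restriction to lines in the space of matrices.
*)

Set Implicit Arguments.
Unset Strict Implicit.
Unset Printing Implicit Defensive.

Import Order.TTheory GRing.Theory Num.Theory numFieldNormedType.Exports.
Local Open Scope ring_scope.

(** * Pluecker relations *)

Section Minors.
Variables (K : fieldType) (r n : nat).
Implicit Types (A : 'M[K]_(r.+1, n.+1)) (w u : 'I_r.+1 -> 'I_n.+1).
Implicit Types (x : 'rV[K]_(plucker_dim r n)) (J : {set 'I_n.+1}).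

(** Columns are listed by an arbitrary function, so that replacing one of them involves no sorting
    and no sign. *)
Definition minor A w : K := \det (colsub w A).

Definition setw w (i : 'I_r.+1) (j : 'I_n.+1) : 'I_r.+1 -> 'I_n.+1 :=
  fun i' => if i' == i then j else w i'.

Lemma setw_eq w i j : setw w i j i = j.
Proof. by rewrite /setw eqxx. Qed.

Lemma setw_neq w i j i' : i' != i -> setw w i j i' = w i'.
Proof. by rewrite /setw => /negPf ->. Qed.

Lemma setw_id w i : setw w i (w i) = w.
Proof. by apply/funext => i'; rewrite /setw; case: eqP => // ->. Qed.

Lemma minor_setw A w i j :
  minor A (setw w i j) = \sum_m A m j * cofactor (colsub w A) m i.
Proof.
rewrite /minor (expand_det_col _ i); apply: eq_bigr => m _.
rewrite !mxE setw_eq; congr (_ * (_ * \det _)).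
by apply/matrixP => a b; rewrite !mxE setw_neq // eq_sym neq_lift.
Qed.

(** Cramer's rule for column [j] against the columns [w], with the denominator cleared. It comes
    from [B *m \adj B = (\det B)%:M] for [B = colsub w A], so [B] may be singular. *)
Lemma minor_cramer A w m j :
  minor A w * A m j = \sum_i minor A (setw w i j) * A m (w i).
Proof.
under eq_bigr => i _ do rewrite minor_setw mulr_suml.
rewrite exchange_big /=.
transitivity (\sum_m' A m' j * (minor A w * (m == m')%:R)).
  rewrite (bigD1 m) //= eqxx mulr1 mulrC big1 ?addr0 // => m' /negPf.
  by rewrite eq_sym => ->; rewrite !mulr0.
apply: eq_bigr => m' _.
have /matrixP/(_ m m') := mul_mx_adj (colsub w A).
rewrite !mxE mulr_natr => <-; rewrite mulr_sumr; apply: eq_bigr => i _.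
by rewrite !mxE -mulrA [X in _ * X]mulrC.
Qed.

(** The minor [setw u i j] is linear in the column put at place [i], so Cramer's rule for column [j]
    can be substituted there. *)
Lemma minor_exchange A w u i j :
  minor A w * minor A (setw u i j) =
  \sum_i' minor A (setw w i' j) * minor A (setw u i (w i')).
Proof.
rewrite minor_setw mulr_sumr.
under [RHS]eq_bigr => i' _ do rewrite (minor_setw A u) mulr_sumr.
rewrite exchange_big /=; apply: eq_bigr => m _.
by rewrite mulrA minor_cramer mulr_suml; apply: eq_bigr => i' _; rewrite mulrA.
Qed.

Lemma minor_noninj A w : ~~ injectiveb w -> minor A w = 0.
Proof.
move=> /injectivePn[i1 [i2 ne eqw]]; rewrite /minor -det_tr.
by apply: (determinant_alternate ne) => m; rewrite !mxE eqw.
Qed.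

Lemma minor_setw_dup A w i i' :
  minor A (setw w i (w i')) = (i == i')%:R * minor A w.
Proof.
case: eqP => [<-|/eqP ne]; first by rewrite setw_id mul1r.
rewrite mul0r minor_noninj //; apply/injectivePn; exists i, i' => //.
by rewrite setw_eq setw_neq // eq_sym.
Qed.

Lemma minor_mulmx (B : 'M[K]_r.+1) A w : minor (B *m A) w = \det B * minor A w.
Proof. by rewrite /minor -mulmx_colsub det_mulmx. Qed.

Definition enumw J : 'I_r.+1 -> 'I_n.+1 := fun i => nth ord0 (enum J) i.

Lemma pluckerE A k : plucker A ord0 k = minor A (enumw (enum_val k)).
Proof. by rewrite !mxE; congr (\det _); apply/matrixP => a b; rewrite !mxE. Qed.

Lemma plucker_indexP (k : 'I_(plucker_dim r n)) : #|enum_val k| = r.+1.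
Proof. by have := enum_valP k; rewrite inE => /eqP. Qed.

Lemma enumw_inj J : #|J| = r.+1 -> injective (enumw J).
Proof.
move=> cJ i j /eqP; rewrite /enumw nth_uniq ?enum_uniq -?cardE ?cJ //.
by move/eqP/val_inj.
Qed.

Lemma enumw_mem J i : #|J| = r.+1 -> enumw J i \in J.
Proof. by move=> cJ; rewrite -mem_enum mem_nth // -cardE cJ. Qed.

Lemma imset_enumw J : #|J| = r.+1 -> [set enumw J i | i : 'I_r.+1] = J.
Proof.
move=> cJ; apply/eqP; rewrite eqEcard card_imset ?card_ord ?cJ ?leqnn ?andbT.
  by apply/fintype.subsetP => _ /imsetP[i _ ->]; exact: enumw_mem.
exact: enumw_inj.
Qed.

(* The linear form on Plucker coordinates that computes the minor on the
   columns [w], in any order and possibly repeated: the determinant is that of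
   the permutation matrix sorting [w], and the sum is empty when [w] is not
   injective. *)
Definition pcoord w x : K :=
  \sum_(k | enum_val k == [set w i | i : 'I_r.+1])
    \det (\matrix_(i, j) (w j == enumw (enum_val k) i)%:R) * x ord0 k.

Lemma pcoord_noninj w x : ~~ injectiveb w -> pcoord w x = 0.
Proof.
move=> winj; rewrite /pcoord big1 // => k /eqP ek; exfalso.
move/injectiveP: winj; apply.
have /imset_injP winj : #|[set w i | i in 'I_r.+1]| == #|'I_r.+1|.
  by rewrite -ek plucker_indexP card_ord.
by move=> i j; apply: winj.
Qed.

Lemma pcoord_plucker w A : pcoord w (plucker A) = minor A w.
Proof.
have [/injectiveP winj|winj] := boolP (injectiveb w); last first.
  by rewrite pcoord_noninj // minor_noninj.
have Wk : [set w i | i : 'I_r.+1] \in plucker_index r n.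
  by rewrite inE card_imset // card_ord.
have eqk k : (enum_val k == [set w i | i : 'I_r.+1]) =
             (k == enum_rank_in Wk [set w i | i : 'I_r.+1]).
  apply/eqP/eqP => [ek|->]; last by rewrite enum_rankK_in.
  by apply: enum_val_inj; rewrite enum_rankK_in.
rewrite /pcoord (eq_bigl _ _ eqk) big_pred1_eq pluckerE /minor mulrC -det_mulmx.
rewrite enum_rankK_in //; congr (\det _); apply/matrixP => i j; rewrite !mxE.
have cW : #|[set w i | i : 'I_r.+1]| = r.+1 by rewrite card_imset // card_ord.
have : w j \in [set w i | i : 'I_r.+1] by apply: imset_f.
rewrite -{1}(imset_enumw cW) => /imsetP[m _ wj].
rewrite (bigD1 m) //= !mxE -wj eqxx mulr1 big1 ?addr0 // => m' ne.
rewrite !mxE wj (inj_eq (enumw_inj cW)) eq_sym (negPf ne) mulr0 //.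
Qed.

Lemma pcoord_enumw k x : pcoord (enumw (enum_val k)) x = x ord0 k.
Proof.
rewrite /pcoord imset_enumw ?plucker_indexP // (big_pred1 k); last first.
  by move=> k' /=; rewrite (inj_eq enum_val_inj).
rewrite (_ : (\matrix_(i, j) _) = 1%:M) ?det1 ?mul1r //.
apply/matrixP => i j; rewrite !mxE (inj_eq (enumw_inj (plucker_indexP k))).
by rewrite eq_sym.
Qed.

Lemma pcoord_setw_dup w i i' x :
  pcoord (setw w i (w i')) x = (i == i')%:R * pcoord w x.
Proof.
case: eqP => [<-|/eqP ne]; first by rewrite setw_id mul1r.
rewrite mul0r pcoord_noninj //; apply/injectivePn; exists i, i' => //.
by rewrite setw_eq setw_neq // eq_sym.
Qed.

Lemma eq_pcoord w x (y : 'rV[K]_(plucker_dim r n)) :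
  (forall k, enum_val k = [set w i | i : 'I_r.+1] -> x ord0 k = y ord0 k) ->
  pcoord w x = pcoord w y.
Proof. by move=> xy; apply: eq_bigr => k /eqP /xy ->. Qed.

Lemma pcoord_e_point w J :
  [set w i | i : 'I_r.+1] != J -> pcoord w (e_point K r J) = 0.
Proof.
move=> ne; rewrite /pcoord big1 // => k /eqP ek.
by rewrite mxE ek (negPf ne) mulr0.
Qed.

Lemma minor_row_free A w : minor A w != 0 -> row_free A.
Proof.
move=> nz; apply/row_freeP; exists ((colsub w 1%:M) *m invmx (colsub w A)).
rewrite mulmxA [A *m _](_ : _ = colsub w A) ?mulmxV ?unitmxE ?unitfE //.
by rewrite mulmx_colsub mulmx1.
Qed.

Lemma minor_neq0_plucker A w : minor A w != 0 -> plucker A != 0.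
Proof.
apply: contraNneq => pA0; rewrite -pcoord_plucker pA0 /pcoord big1 // => k _.
by rewrite mxE mulr0.
Qed.

Lemma row_free_plucker A : row_free A = (plucker A != 0).
Proof.
apply/idP/idP => [/row_freeP[B AB]|/eqP nz].
  have rA : row_full A^T.
    by apply/row_fullP; exists B^T; rewrite -trmx_mul AB trmx1.
  have := fullrowsub_unit rA; rewrite unitmxE unitfE => nz.
  apply: (@minor_neq0_plucker _ (fullrankfun rA)).
  by rewrite /minor -det_tr trmx_mxsub.
have [k nzk] : exists k, plucker A ord0 k != 0.
  apply/existsP; apply/existsPn => pA0; apply: nz.
  by apply/rowP => k; rewrite [RHS]mxE; apply/eqP/negPn/pA0.
by move: nzk; rewrite pluckerE; apply: minor_row_free.
Qed.

Lemma plucker_mulmx (B : 'M[K]_r.+1) A : plucker (B *m A) = \det B *: plucker A.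
Proof. by apply/rowP => k; rewrite [RHS]mxE !pluckerE minor_mulmx. Qed.

(** When [minor A w] is nonzero, these are, up to that factor, the coordinates of column [j] in the
    basis of the columns [w]. *)
Lemma minor_adj A w i j : (\adj (colsub w A) *m A) i j = minor A (setw w i j).
Proof.
by rewrite minor_setw !mxE; apply: eq_bigr => m _; rewrite !mxE mulrC.
Qed.

End Minors.

(** * Osculating spaces *)

Section VanishingOrder.
Variables (K : numFieldType) (d : nat) (U : set 'rV[K]_d).
Hypotheses (openU : open U) (U0 : U 0).
Implicit Types (f g : 'rV[K]_d -> K) (a : seq 'I_d) (m : nat).

Definition spartial a f : 'rV[K]_d -> K :=
  foldr (fun i g => 'D_(delta_mx ord0 i) g) f a.

(** Derivability is demanded at every order, which lets the product rule be iterated; for [m = 0]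
    nothing else is demanded. *)
Definition vanish_order m f := forall a,
  (forall i t, U t -> derivable (spartial a f) t (delta_mx ord0 i)) /\
  ((size a < m)%N -> spartial a f 0 = 0).

Lemma near_open t : U t -> \forall x \near t, U x.
Proof. by move=> Ut; apply: open_nbhs_nbhs; split. Qed.

Lemma spartial_rcons a i f :
  spartial (rcons a i) f = spartial a ('D_(delta_mx ord0 i) f).
Proof. by rewrite /spartial -cats1 foldr_cat. Qed.

Lemma spartial_ext f g : (forall t, U t -> f t = g t) ->
  forall a t, U t -> spartial a f t = spartial a g t.
Proof.
move=> fg; elim=> [|i a IH] t Ut /=; first exact: fg.
by apply: near_eq_derive; apply: filterS (near_open Ut) => x /IH.
Qed.

Lemma vanish_order_ext m f g : (forall t, U t -> f t = g t) ->
  vanish_order m f -> vanish_order m g.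
Proof.
move=> fg vf a; have [df f0] := vf a; have efg := spartial_ext fg a; split.
  move=> i t Ut; apply: near_eq_derivable (df i t Ut).
  by apply: filterS (near_open Ut) => x /efg.
by move=> /f0; rewrite efg.
Qed.

Lemma vanish_order_derive m f i :
  vanish_order m f -> vanish_order m.-1 ('D_(delta_mx ord0 i) f).
Proof.
move=> vf a; rewrite -spartial_rcons; have [df f0] := vf (rcons a i); split=> //.
by move=> sa; apply: f0; rewrite size_rcons -ltn_predRL.
Qed.

(** Derivability is asked only below order [size a], which is what the induction in [vanish_orderM]
    can supply. *)
Lemma spartialD a f g :
  (forall b i t, (size b < size a)%N -> U t ->
     derivable (spartial b f) t (delta_mx ord0 i)) ->
  (forall b i t, (size b < size a)%N -> U t ->
     derivable (spartial b g) t (delta_mx ord0 i)) ->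
  forall t, U t -> spartial a (f \+ g) t = spartial a f t + spartial a g t.
Proof.
elim: a => [|i a IH] //= df dg t Ut.
rewrite -deriveD; [|by apply: df|by apply: dg].
apply: near_eq_derive; apply: filterS (near_open Ut) => x /IH; apply.
  by move=> b j s sb; apply: df; exact: ltnW.
by move=> b j s sb; apply: dg; exact: ltnW.
Qed.

Lemma vanish_orderD m f g :
  vanish_order m f -> vanish_order m g -> vanish_order m (f \+ g).
Proof.
move=> vf vg a; have [df f0] := vf a; have [dg g0] := vg a.
have eD t : U t -> spartial a (f \+ g) t = spartial a f t + spartial a g t.
  by apply: spartialD => b i s _; [apply: (vf b).1|apply: (vg b).1].
split=> [i t Ut|sa]; last by rewrite eD // f0 // g0 // addr0.
have := derivableD (df i t Ut) (dg i t Ut); apply: near_eq_derivable.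
by apply: filterS (near_open Ut) => x /eD.
Qed.

Lemma vanish_order_cst c : vanish_order 0 (fun=> c).
Proof.
move=> a; split=> // i t Ut.
suff [c' ->] : exists c', spartial a (fun=> c) = cst c' by apply: derivable_cst.
elim: a => [|j a [c' IH]] /=; first by exists c.
by exists 0; apply/funext => x; rewrite IH derive_cst.
Qed.

Lemma vanish_order0 m : vanish_order m (fun=> 0).
Proof.
move=> a; split; first by apply: (vanish_order_cst 0 a).1.
move=> _; suff -> : spartial a (fun=> 0) = cst 0 by [].
elim: a => [|j a IH] //=.
by apply/funext => x; rewrite IH derive_cst.
Qed.

Lemma vanish_order_sum m (I : Type) (s : seq I) (P : pred I) F :
  (forall i, P i -> vanish_order m (F i)) ->
  vanish_order m (fun t => \sum_(i <- s | P i) F i t).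
Proof.
move=> vF; elim: s => [|i s IH].
  by apply: vanish_order_ext (vanish_order0 m) => t _; rewrite big_nil.
case: (boolP (P i)) => Pi; last first.
  by apply: vanish_order_ext IH => t _; rewrite big_cons (negPf Pi).
apply: vanish_order_ext (vanish_orderD (vF i Pi) IH) => t _.
by rewrite big_cons Pi.
Qed.

(** Leibniz rule: one derivative turns the product into a sum of two products, in each of which a
    single order drops by at most one. *)
Lemma vanish_orderM m1 m2 f g : vanish_order m1 f -> vanish_order m2 g ->
  vanish_order (m1 + m2) (fun t => f t * g t).
Proof.
move=> vf vg a; have [k] := ubnP (size a).
elim: k a m1 m2 f g vf vg => // k IH a m1 m2 f g vf vg sa.
have df := (vf [::]).1; have dg := (vg [::]).1.
(* The last index of the list is the innermost derivative, the one that acts on the product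
   itself. *)
case/lastP: a sa => [|a i] sa.
  split=> [i t Ut|/= m12]; first by apply: derivableM; [apply: df|apply: dg].
  case: m1 m12 vf => [m12 vf|m1 _ vf]; last by rewrite [f 0](vf [::]).2 ?mul0r.
  by rewrite [g 0](vg [::]).2 ?mulr0.
rewrite size_rcons ltnS in sa.
pose f1 := 'D_(delta_mx ord0 i) f; pose g1 := 'D_(delta_mx ord0 i) g.
have eD t : U t ->
    'D_(delta_mx ord0 i) (fun t => f t * g t) t = f t * g1 t + g t * f1 t.
  by move=> Ut; rewrite deriveM; [|exact: df|exact: dg].
have vf1 : vanish_order m1.-1 f1 by exact: vanish_order_derive.
have vg1 : vanish_order m2.-1 g1 by exact: vanish_order_derive.
have IH1 b (sb : (size b < k)%N) := IH b _ _ _ _ vf vg1 sb.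
have IH2 b (sb : (size b < k)%N) := IH b _ _ _ _ vg vf1 sb.
have eDa t : U t -> spartial (rcons a i) (fun t => f t * g t) t =
    spartial a (fun t => f t * g1 t) t + spartial a (fun t => g t * f1 t) t.
  move=> Ut; rewrite spartial_rcons (spartial_ext eD) //.
  by apply: spartialD => // b j s sb;
    [apply: (IH1 b _).1|apply: (IH2 b _).1]; exact: ltn_trans sa.
split=> [j t Ut|].
  have := derivableD ((IH1 a sa).1 j t Ut) ((IH2 a sa).1 j t Ut).
  apply: near_eq_derivable.
  by apply: filterS (near_open Ut) => x /eDa.
rewrite size_rcons => sm; rewrite eDa // (IH1 a sa).2 ?(IH2 a sa).2 ?addr0 //.
  by move: sm; clear; lia.
by move: sm; clear; lia.
Qed.

End VanishingOrder.

Section CoordinatePartial.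
Variables (K : numFieldType) (d N : nat) (U : set 'rV[K]_d).
Variable phi : 'rV[K]_d -> 'rV[K]_N.
Hypotheses (openU : open U).
Hypothesis smooth : forall (a : seq 'I_d) t, U t ->
  differentiable (iter_partial a phi) t.

Lemma derive_coord (f : 'rV[K]_d -> 'rV[K]_N) t v (k : 'I_N) :
  differentiable f t ->
  derivable (fun t => f t ord0 k) t v /\
  'D_v (fun t => f t ord0 k) t = 'D_v f t ord0 k.
Proof.
move=> df.
have @c : {linear 'rV[K]_N -> K}.
  by exists (fun u : 'rV[K]_N => u ord0 k); do 2![eexists]; do ?[constructor];
     rewrite ?mxE// => ? *; rewrite ?mxE//; move=> ?; rewrite !mxE.
have dc : differentiable (c : _ -> _) (f t).
  exact: differentiable_coord.
have dcf : differentiable ((c : _ -> _) \o f) t by exact: differentiable_comp.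
split; first exact: (@diff_derivable _ _ _ ((c : _ -> _) \o f)).
transitivity ('D_v ((c : _ -> _) \o f) t) => //.
rewrite (deriveE v dcf) (deriveE v df) diff_comp //.
have cc : continuous (c : _ -> _) by exact: coord_continuous.
exact: (congr1 (fun h => h ('d f t v)) (diff_lin (f t) cc)).
Qed.

Lemma spartial_coord (k : 'I_N) (a : seq 'I_d) t : U t ->
  spartial a (fun t => phi t ord0 k) t = iter_partial a phi t ord0 k.
Proof.
elim: a t => [|i a IH] t Ut //=.
rewrite -(derive_coord _ _ (smooth a Ut)).2.
by apply: near_eq_derive; apply: filterS (near_open openU Ut) => x /IH.
Qed.

Lemma vanish_order_coord (k : 'I_N) : vanish_order U 0 (fun t => phi t ord0 k).
Proof.
move=> a; split=> // i t Ut.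
apply: near_eq_derivable (derive_coord (delta_mx ord0 i) k (smooth a Ut)).1.
by apply: filterS (near_open openU Ut) => x /spartial_coord ->.
Qed.

End CoordinatePartial.

(** * Vanishing of Pluecker coordinates on osculating spaces *)

Section OsculatingGrassmannian.
Variables (K : numFieldType) (r n : nat) (I : {set 'I_n.+1}).

(* By [minor_exchange], on the chart [x_I = 1] each coordinate at distance
   [m.+1] from [I] is a combination of products of one at distance 1 and one at
   distance [m]. *)
Lemma vanish_order_pcoord d k (U : set 'rV[K]_d) phi
    (lp : local_parametrization (grassmannian K r n) (e_point K r I) k U phi)
    m w :
  (m <= #|[set i | w i \notin I]|)%N ->
  vanish_order U m (fun t => pcoord w (phi t)).
Proof.
have [oU U0 [_ [c nzc phi0]] chart smooth _ _ _] := lp.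
(* The chart coordinate is that of [I]: it equals 1 at [phi 0], while all other coordinates of
   [e_point] vanish. *)
have ekI : enum_val k = I.
  have := (chart _ U0).2; rewrite phi0 !mxE; case: eqP => // _.
  by rewrite mulr0 => /eqP; rewrite eq_sym oner_eq0.
have vsm w' : vanish_order U 0 (fun t => pcoord w' (phi t)).
  apply: vanish_order_sum => // k' _.
  apply: (@vanish_orderM _ _ _ oU U0 0 0); first exact: vanish_order_cst.
  exact: vanish_order_coord.
elim: m w => [|m IH] w cw; first exact: vsm.
have [ i ] : exists i, i \in [set i | w i \notin I].
  by apply/finset.set0Pn; rewrite -card_gt0; exact: leq_trans cw.
rewrite inE => wi.
(* Exchange relation between [I] and [w], where column [w i] of [w] is replaced by itself; the
   factor [x_I] is 1. *)
have E t : U t -> \sum_i' pcoord (setw (enumw I) i' (w i)) (phi t) *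
    pcoord (setw w i (enumw I i')) (phi t) = pcoord w (phi t).
  move=> Ut; have [[A rA ephi] pk] := chart t Ut.
  have := minor_exchange A (enumw I) w i (w i).
  rewrite setw_id -!pcoord_plucker ephi -{1}ekI pcoord_enumw pk mul1r => ->.
  by apply: eq_bigr => i' _; rewrite -!pcoord_plucker ephi.
apply: (vanish_order_ext oU U0 E); apply: vanish_order_sum => // i' _.
(* The first factor vanishes at [e_I], as its columns include [w i], outside [I]. The second keeps
   every column of [w] outside [I] except the one at place [i], so the induction hypothesis applies
   to it. *)
rewrite -add1n; apply: vanish_orderM => //; last first.
  apply: IH; have : [set i | w i \notin I] :\ i \subset
      [set j | setw w i (enumw I i') j \notin I].
    by apply/fintype.subsetP => j; rewrite !inE => /andP[ne]; rewrite setw_neq.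
  move/subset_leq_card; apply: leq_trans.
  by move: cw; rewrite (cardsD1 i) inE wi add1n ltnS.
move=> a; split; first exact: (vsm _ a).1.
case: a => // _ /=.
rewrite phi0; have : pcoord (setw (enumw I) i' (w i)) (e_point K r I) = 0.
  apply: pcoord_e_point; apply: contraNneq wi => <-.
  by apply/imsetP; exists i' => //; rewrite setw_eq.
move=> p0; rewrite /pcoord; under eq_bigr do rewrite mxE mulrCA.
by rewrite -mulr_sumr [X in _ * X]p0 mulr0.
Qed.

(** [T] is spanned by derivatives at 0 of order at most [s], whereas [vanish_order_pcoord] makes
    coordinate [k] of the parametrization vanish there to order [s.+1]. *)
Lemma osculating_coord0 s T k :
  osculating_space (grassmannian K r n) (e_point K r I) s T ->
  (s < #|enum_val k :\: I|)%N -> forall x, x \in T -> x ord0 k = 0.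
Proof.
move=> [d [k0 [U [phi [lp ->]]]]] sk x.
case/memv_sumP=> v vT ->; rewrite summxE big1 // => m _.
have /memv_sumP[u uT ->] := vT m isT; rewrite summxE big1 // => a _.
have /vlineP[c ->] := uT a isT; rewrite mxE.
have [oU U0 _ _ smooth _ _ _] := lp.
rewrite -(spartial_coord oU smooth) //.
have vk : vanish_order U s.+1 (fun t => phi t ord0 k).
  have : vanish_order U s.+1 (fun t => pcoord (enumw (enum_val k)) (phi t)).
    apply: (vanish_order_pcoord lp); apply: leq_trans sk _.
    have ck := plucker_indexP k.
    rewrite -[enum_val k in X in (X <= _)%N](imset_enumw ck).
    rewrite -(card_imset _ (enumw_inj ck)).
    apply: subset_leq_card; apply/fintype.subsetP => j.
    rewrite inE => /andP[jI /imsetP[i _ ej]]; apply/imsetP; exists i => //.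
    by rewrite inE -ej.
  by apply: vanish_order_ext => // t _; rewrite pcoord_enumw.
by rewrite (vk a).2 ?mulr0 // size_tuple.
Qed.

End OsculatingGrassmannian.

(** * Homogeneous polynomial functions *)

Section HomogeneousFunctions.
Variables (K : fieldType) (N : nat).
Implicit Types (f g : 'rV[K]_N -> K) (d e : nat).

Definition hpoly d f :=
  exists2 F : mpoly.mpoly N K, homogeneous d F & forall v, f v = evalp v F.

Lemma hpoly_ext d f g : f =1 g -> hpoly d f -> hpoly d g.
Proof. by move=> fg [F hF fF]; exists F => // v; rewrite -fg fF. Qed.

Lemma hpoly0 d : hpoly d (fun=> 0).
Proof.
exists 0; first exact: mpoly.dhomog0.
by move=> v; rewrite /evalp mpoly.meval0.
Qed.

Lemma hpoly1 : hpoly 0 (fun=> 1).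
Proof.
exists 1; first exact: mpoly.dhomog1.
by move=> v; rewrite /evalp mpoly.meval1.
Qed.

Lemma hpolyD d f g : hpoly d f -> hpoly d g -> hpoly d (fun v => f v + g v).
Proof.
move=> [F hF fF] [G hG gG]; exists (F + G); first exact: mpoly.dhomogD.
by move=> v; rewrite fF gG /evalp mpoly.mevalD.
Qed.

Lemma hpolyZ d c f : hpoly d f -> hpoly d (fun v => c * f v).
Proof.
move=> [F hF fF]; exists (c *: F); first exact: mpoly.dhomogZ.
by move=> v; rewrite fF /evalp mpoly.mevalZ.
Qed.

Lemma hpolyM d e f g :
  hpoly d f -> hpoly e g -> hpoly (d + e) (fun v => f v * g v).
Proof.
move=> [F hF fF] [G hG gG]; exists (F * G); first exact: mpoly.dhomogM.
by move=> v; rewrite fF gG /evalp mpoly.mevalM.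
Qed.

Lemma hpoly_sum d (I : Type) (s : seq I) (P : pred I) F :
  (forall i, hpoly d (F i)) -> hpoly d (fun v => \sum_(i <- s | P i) F i v).
Proof.
move=> hF; elim: s => [|i s IH].
  by apply: hpoly_ext (hpoly0 d) => v; rewrite big_nil.
case: (boolP (P i)) => Pi; last first.
  by apply: hpoly_ext IH => v; rewrite big_cons (negPf Pi).
by apply: hpoly_ext (hpolyD (hF i) IH) => v; rewrite big_cons Pi.
Qed.

Lemma hpoly_prod d (I : Type) (s : seq I) (P : pred I) F :
  (forall i, hpoly d (F i)) ->
  hpoly (count P s * d) (fun v => \prod_(i <- s | P i) F i v).
Proof.
move=> hF; elim: s => [|i s IH] /=.
  by apply: hpoly_ext hpoly1 => v; rewrite big_nil.
case: (boolP (P i)) => Pi; last first.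
  by apply: hpoly_ext IH => v; rewrite big_cons (negPf Pi).
rewrite mulnDl mul1n.
by apply: hpoly_ext (hpolyM (hF i) IH) => v; rewrite big_cons Pi.
Qed.

Lemma hpolyX d f m : hpoly d f -> hpoly (m * d) (fun v => f v ^+ m).
Proof.
move=> hf; elim: m => [|m IH]; first exact: hpoly1.
by apply: hpoly_ext (hpolyM hf IH) => v; rewrite exprS.
Qed.

Lemma hpoly_det d m (B : 'rV[K]_N -> 'M[K]_m) :
  (forall i j, hpoly d (fun v => B v i j)) ->
  hpoly (m * d) (fun v => \det (B v)).
Proof.
move=> hB; apply: hpoly_sum => s; apply: hpolyZ.
have := @hpoly_prod d _ (index_enum 'I_m) xpredT _ (fun i => hB i (s i)).
by rewrite -sum1_count sum1_card card_ord.
Qed.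

Lemma hpoly_coord i : hpoly 1 (fun v => v ord0 i).
Proof.
exists (mpoly.mpolyX K (mpoly.mnm1 i)).
  by rewrite /homogeneous mpoly.dhomogX; apply/eqP; exact: mpoly.mdeg1.
by move=> v; rewrite /evalp mpoly.mevalXU.
Qed.

Lemma hpoly_linear M (L : 'Hom('rV[K]_N, 'rV[K]_M)) i :
  hpoly 1 (fun v => L v ord0 i).
Proof.
apply: (@hpoly_ext _ (fun v => \sum_j L (delta_mx ord0 j) ord0 i * v ord0 j)).
  move=> v; rewrite {2}(row_sum_delta v) linear_sum summxE.
  by apply: eq_bigr => j _; rewrite linearZ mxE mulrC.
by apply: hpoly_sum => j; apply/hpolyZ/hpoly_coord.
Qed.

Lemma homogeneous_mapP M d (f : 'rV[K]_N -> 'rV[K]_M) :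
  (forall i, hpoly d (fun v => f v ord0 i)) -> homogeneous_map f.
Proof.
move=> /fin_all_exists2[F hF fF]; exists d, F; split=> // v.
by apply/rowP => i; rewrite mxE.
Qed.

Lemma zariski_closed_neq0 : zariski_closed [set v : 'rV[K]_N | v != 0]%classic.
Proof.
exists set0 => //; apply/seteqP; split=> v /=; last by case.
by move=> ->; split.
Qed.

Lemma zariski_closed_hpoly d f : hpoly d f ->
  zariski_closed [set v : 'rV[K]_N | v != 0 /\ f v = 0]%classic.
Proof.
move=> [F hF fF]; exists [set F]%classic; first by move=> _ ->; exists d.
apply/seteqP; split=> v /= [nz fv]; split=> //; first by move=> _ ->; rewrite -fF.
by rewrite fF fv.
Qed.

End HomogeneousFunctions.

(** * Polynomial functions on lines in a space of matrices *)

Section PolynomialsOnLines.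
Variable K : numFieldType.

Definition polyfun (h : K -> K) := exists p : {poly K}, forall t, h t = p.[t].

Lemma polyfun_ext f g : f =1 g -> polyfun f -> polyfun g.
Proof. by move=> fg [p fp]; exists p => t; rewrite -fg. Qed.

Lemma polyfun_cst c : polyfun (fun=> c).
Proof. by exists c%:P => t; rewrite hornerC. Qed.

Lemma polyfun_id : polyfun id.
Proof. by exists 'X => t; rewrite hornerX. Qed.

Lemma polyfunD f g : polyfun f -> polyfun g -> polyfun (fun t => f t + g t).
Proof. by move=> [p fp] [q gq]; exists (p + q) => t; rewrite fp gq hornerD. Qed.

Lemma polyfunM f g : polyfun f -> polyfun g -> polyfun (fun t => f t * g t).
Proof. by move=> [p fp] [q gq]; exists (p * q) => t; rewrite fp gq hornerM. Qed.

Lemma polyfun_sum (I : Type) (s : seq I) (P : pred I) F :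
  (forall i, polyfun (F i)) -> polyfun (fun t => \sum_(i <- s | P i) F i t).
Proof.
move=> hF; elim: s => [|i s IH].
  by apply: polyfun_ext (polyfun_cst 0) => t; rewrite big_nil.
case: (boolP (P i)) => Pi; last first.
  by apply: polyfun_ext IH => t; rewrite big_cons (negPf Pi).
by apply: polyfun_ext (polyfunD (hF i) IH) => t; rewrite big_cons Pi.
Qed.

Lemma polyfun_prod (I : Type) (s : seq I) (P : pred I) F :
  (forall i, polyfun (F i)) -> polyfun (fun t => \prod_(i <- s | P i) F i t).
Proof.
move=> hF; elim: s => [|i s IH].
  by apply: polyfun_ext (polyfun_cst 1) => t; rewrite big_nil.
case: (boolP (P i)) => Pi; last first.
  by apply: polyfun_ext IH => t; rewrite big_cons (negPf Pi).
by apply: polyfun_ext (polyfunM (hF i) IH) => t; rewrite big_cons Pi.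
Qed.

Lemma polyfunX f m : polyfun f -> polyfun (fun t => f t ^+ m).
Proof. by move=> [p fp]; exists (p ^+ m) => t; rewrite fp horner_exp. Qed.

Lemma polyfun_det m (B : K -> 'M[K]_m) :
  (forall i j, polyfun (fun t => B t i j)) -> polyfun (fun t => \det (B t)).
Proof.
move=> hB; apply: polyfun_sum => s; apply: polyfunM; first exact: polyfun_cst.
by apply: polyfun_prod => i; exact: hB.
Qed.

Lemma polyfun_hpoly N d f (v : K -> 'rV[K]_N) : hpoly d f ->
  (forall i, polyfun (fun t => v t ord0 i)) -> polyfun (fun t => f (v t)).
Proof.
move=> [F _ fF] hv.
apply: (@polyfun_ext (fun t => evalp (v t) F)) => [t|]; first by rewrite fF.
apply: (@polyfun_ext (fun t => \sum_(m <- mpoly.msupp F)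
    mpoly.mcoeff m F * \prod_i v t ord0 i ^+ mpoly.fun_of_multinom m i)) => [t|].
  by rewrite /evalp mpoly.mevalE.
apply: polyfun_sum => m; apply: polyfunM; first exact: polyfun_cst.
by apply: polyfun_prod => i; exact/polyfunX/hv.
Qed.

Lemma poly_nonroot (p : {poly K}) : p != 0 -> exists t, p.[t] != 0.
Proof.
move=> nz; apply: contrapT => noroot; move/eqP: nz; apply.
(* In characteristic 0 the first [size p] natural numbers are distinct, and they exceed the degree
   in number. *)
apply: (@roots_geq_poly_eq0 _ _ [seq i%:R | i <- iota 0 (size p)]).
- apply/allP => _ /mapP[i _ ->]; apply/negPn/negP => ri.
  by apply: noroot; exists i%:R.
- by rewrite map_inj_uniq ?iota_uniq // => i j /eqP; rewrite eqr_nat => /eqP.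
- by rewrite size_map size_iota.
Qed.

Variables (a b : nat).
Implicit Types (A B : 'M[K]_(a, b)).

(* The line joining [A1] to [A] lies in the set [c != 0] up to finitely many
   points. *)
Lemma polyfun_dense (f c : 'M[K]_(a, b) -> K) A1 :
  (forall A B, polyfun (fun t => f (A + t *: B))) ->
  (forall A B, polyfun (fun t => c (A + t *: B))) ->
  c A1 != 0 -> (forall A, c A != 0 -> f A = 0) -> forall A, f A = 0.
Proof.
move=> lf lc cA1 fc A.
have [p fp] := lf A1 (A - A1); have [q cq] := lc A1 (A - A1).
have nzq : q != 0.
  apply: contraNneq cA1 => q0.
  by rewrite -[A1]addr0 -(scale0r (A - A1)) cq q0 horner0.
have fA : f A = p.[1] by rewrite -fp scale1r addrC subrK.
rewrite fA; have [->|nzp] := eqVneq p 0; first by rewrite horner0.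
have /poly_nonroot[t] : q * p != 0 by rewrite mulf_neq0.
rewrite hornerM mulf_eq0 negb_or -(cq t) -(fp t) => /andP[/fc ->].
by rewrite eqxx.
Qed.

End PolynomialsOnLines.

(** * Inverse of the projection *)

Section Reconstruction.
Variables (K : fieldType) (r n : nat).
Variables (w0 : 'I_r.+1 -> 'I_n.+1) (k : 'I_n.+1).
Variable sel : 'I_n.+1 -> option 'I_r.+1.
Hypothesis selw0 : forall m, sel (w0 m) = None.
Implicit Types (x : 'rV[K]_(plucker_dim r n)) (A : 'M[K]_(r.+1, n.+1)).

Let wk m := setw w0 m k.

(** A common denominator for all the changes of basis from [wk m] back to [w0]. *)
Definition pivots x : K := \prod_m pcoord (wk m) x.

(* A multiple of the matrix of [A] in the basis of the columns [w0], as a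
   function of [x = plucker A]. Column [j] is read off directly from the minors
   [w0] with one entry replaced by [j] when [sel j = None]; otherwise it is first
   expressed in the basis in which [k] replaces column [w0 i0]. *)
Definition rec_mx x : 'M[K]_(r.+1, n.+1) :=
  \matrix_(i, j)
    if sel j is Some i0 then
      (\prod_(m | m != i0) pcoord (wk m) x) *
      ((i != i0)%:R * (pcoord (setw (wk i0) i j) x * pcoord w0 x) +
       pcoord (setw (wk i0) i0 j) x * pcoord (wk i) x)
    else pcoord (setw w0 i j) x * pivots x.

Lemma rec_mx_plucker A :
  rec_mx (plucker A) = pivots (plucker A) *: (\adj (colsub w0 A) *m A).
Proof.
apply/matrixP => i j; rewrite [RHS]mxE minor_adj mxE -pcoord_plucker.
case: (sel j) => [i0|]; last by rewrite mulrC.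
rewrite [in RHS]/pivots [in RHS](bigD1 i0) //= [X in _ = X * _]mulrC -mulrA.
(* Exchange between the bases [wk i0] and [w0]. The term [i0] puts [k] at place [i] of [w0]; any
   other term [i'] puts [w0 i'] there, hence vanishes unless [i' = i]. *)
congr (_ * _); rewrite !pcoord_plucker minor_exchange (bigD1 i0) //= /wk setw_eq.
rewrite addrC; congr (_ + _); case: eqVneq => [->|ne] /=.
  rewrite mul0r big1 // => i' ne; rewrite setw_neq // minor_setw_dup.
  by rewrite eq_sym (negPf ne) mul0r mulr0.
rewrite mul1r (bigD1 i) //= setw_neq // minor_setw_dup eqxx mul1r.
rewrite big1 ?addr0 // => i' /andP[ne0 nei].
by rewrite setw_neq // minor_setw_dup eq_sym (negPf nei) mul0r mulr0.
Qed.

(** The columns [w0] of [rec_mx x] form a scalar matrix even when [x] is not on the Grassmannian.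
    This is why the inverse takes values in the Grassmannian wherever that scalar is nonzero. *)
Lemma minor_rec_mx x : minor (rec_mx x) w0 = (pcoord w0 x * pivots x) ^+ r.+1.
Proof.
rewrite /minor (_ : colsub _ _ = (pcoord w0 x * pivots x)%:M) ?det_scalar //.
apply/matrixP => i j; rewrite !mxE selw0 pcoord_setw_dup.
by case: eqP => _; rewrite ?mul1r ?mul0r ?mulr1n ?mulr0n.
Qed.

Lemma det_adj_mul m (B : 'M[K]_m) : \det (\adj B) * \det B = \det B ^+ m.
Proof. by rewrite -det_mulmx mul_adj_mx det_scalar. Qed.

Lemma plucker_rec_mx A : pcoord w0 (plucker A) != 0 ->
  plucker (rec_mx (plucker A)) =
  (pivots (plucker A) ^+ r.+1 * pcoord w0 (plucker A) ^+ r) *: plucker A.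
Proof.
move=> nz; rewrite rec_mx_plucker -mul_scalar_mx !plucker_mulmx scalerA.
(* The determinant of the adjugate is found by cancelling one factor from [det_adj_mul], whence the
   exponent [r]. *)
rewrite det_scalar; congr (_ * _ *: _); apply: (mulIf nz).
by rewrite -exprSr pcoord_plucker det_adj_mul.
Qed.

(** The linear map [L] is the identity for functions on the source of the projection and [rho] for
    functions on its target. *)
Lemma hpoly_pcoord M (L : 'Hom('rV[K]_M, 'rV[K]_(plucker_dim r n))) w :
  hpoly 1 (fun y => pcoord w (L y)).
Proof. by apply: hpoly_sum => k'; exact/hpolyZ/hpoly_linear. Qed.

Lemma hpoly_pivots M (L : 'Hom('rV[K]_M, 'rV[K]_(plucker_dim r n))) :
  hpoly r.+1 (fun y => pivots (L y)).
Proof.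
have := @hpoly_prod _ M 1 _ (index_enum 'I_r.+1) xpredT _
  (fun m => hpoly_pcoord L (wk m)).
by rewrite -sum1_count sum1_card card_ord muln1.
Qed.

Lemma hpoly_rec_mx M (L : 'Hom('rV[K]_M, 'rV[K]_(plucker_dim r n))) i j :
  hpoly r.+2 (fun y => rec_mx (L y) i j).
Proof.
case ej: (sel j) => [i0|].
  apply: (@hpoly_ext _ _ _ (fun y => (\prod_(m | m != i0) pcoord (wk m) (L y)) *
      ((i != i0)%:R * (pcoord (setw (wk i0) i j) (L y) * pcoord w0 (L y)) +
       pcoord (setw (wk i0) i0 j) (L y) * pcoord (wk i) (L y)))) => [y|].
    by rewrite mxE ej.
  rewrite -(addn2 r); apply: hpolyM; last first.
    by apply: hpolyD; [apply: hpolyZ|]; apply: (@hpolyM _ _ 1 1); exact: hpoly_pcoord.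
  have := @hpoly_prod _ M 1 _ (index_enum 'I_r.+1) (fun m => m != i0) _
    (fun m => hpoly_pcoord L (wk m)).
  by rewrite -sum1_count sum1_card cardC1 card_ord muln1.
apply: (@hpoly_ext _ _ _ (fun y => pcoord (setw w0 i j) (L y) * pivots (L y))) => [y|].
  by rewrite mxE ej.
by rewrite -(add1n r.+1); apply: hpolyM; [exact: hpoly_pcoord|exact: hpoly_pivots].
Qed.

Lemma hpoly_plucker_rec_mx M (L : 'Hom('rV[K]_M, 'rV[K]_(plucker_dim r n))) c :
  hpoly (r.+1 * r.+2) (fun y => plucker (rec_mx (L y)) ord0 c).
Proof.
apply: (@hpoly_ext _ _ _ (fun y => minor (rec_mx (L y)) (enumw (enum_val c)))) => [y|].
  by rewrite pluckerE.
apply: hpoly_det => i j.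
by apply: hpoly_ext (hpoly_rec_mx L i (enumw (enum_val c) j)) => y; rewrite [RHS]mxE.
Qed.

Lemma pivots_generic : injective w0 -> (forall m, w0 m != k) ->
  exists A, pcoord w0 (plucker A) * pivots (plucker A) != 0.
Proof.
move=> w0inj w0k.
(* The columns [w0] form the identity and column [k] consists of ones, so the minors [w0] and [wk m]
   all equal 1. *)
pose A : 'M[K]_(r.+1, n.+1) :=
  \matrix_(i, j) if j == k then 1 else (j == w0 i)%:R.
have A1 : colsub w0 A = 1%:M.
  apply/matrixP => i j; rewrite !mxE (negPf (w0k j)) (inj_eq w0inj).
  by rewrite eq_sym.
exists A; rewrite mulf_neq0 //; first by rewrite pcoord_plucker /minor A1 det1 oner_eq0.
apply/prodf_neq0 => m _; rewrite pcoord_plucker minor_setw A1.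
have adj1 : \adj 1%:M = 1%:M :> 'M[K]_r.+1 by rewrite -[LHS]mul1mx mul_mx_adj det1.
under eq_bigr => a _.
  rewrite mxE eqxx mul1r.
  rewrite (_ : cofactor _ _ _ = (\adj 1%:M : 'M[K]_r.+1) m a); last by rewrite mxE.
  rewrite adj1 mxE.
  over.
rewrite (bigD1 m) //= eqxx big1 ?addr0 ?oner_eq0 // => a /negPf.
by rewrite eq_sym => ->.
Qed.

End Reconstruction.

(** * Birationality of a projection that determines enough minors *)

Section Birational.
Local Open Scope classical_set_scope.
Variables (K : numFieldType) (r n M : nat).
Local Notation N := (plucker_dim r n).
Variables (Pi : 'Hom('rV[K]_N, 'rV[K]_M)) (rho : 'Hom('rV[K]_M, 'rV[K]_N)).

(* [rho] is a partial inverse of [Pi]; the minor [w] of [x] can be read off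
   [Pi x]. *)
Definition known (w : 'I_r.+1 -> 'I_n.+1) :=
  forall x, pcoord w (rho (Pi x)) = pcoord w x.

Variables (w0 : 'I_r.+1 -> 'I_n.+1) (k : 'I_n.+1).
Variable sel : 'I_n.+1 -> option 'I_r.+1.
Hypotheses (w0inj : injective w0) (w0k : forall m, w0 m != k).
Hypothesis selw0 : forall m, sel (w0 m) = None.
Hypotheses (known0 : known w0) (knownk : forall m, known (setw w0 m k)).
Hypothesis known_sel : forall j i, known
  (if sel j is Some i0 then setw (setw w0 i0 k) i j else setw w0 i j).

Local Notation X := (grassmannian K r n).
Local Notation Y := (image_closure X Pi).
Local Notation good x := (pcoord w0 x * pivots w0 k x).
Local Notation inverse y := (plucker (rec_mx w0 k sel (rho y))).

Lemma pcoord0 w : pcoord w (0 : 'rV[K]_N) = 0.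
Proof. by rewrite /pcoord big1 // => i _; rewrite mxE mulr0. Qed.

Lemma good_known (x : 'rV[K]_N) : good (rho (Pi x)) = good x.
Proof. by rewrite known0; congr (_ * _); apply: eq_bigr => m _; exact: knownk. Qed.

Lemma pivots_known (x : 'rV[K]_N) : pivots w0 k (rho (Pi x)) = pivots w0 k x.
Proof. by apply: eq_bigr => m _; exact: knownk. Qed.

Lemma rec_mx_known (x : 'rV[K]_N) : rec_mx w0 k sel (rho (Pi x)) = rec_mx w0 k sel x.
Proof.
apply/matrixP => i j; rewrite !mxE; have := known_sel j.
case: (sel j) => [i0|] kj; last by rewrite kj pivots_known.
rewrite !kj known0 knownk; congr (_ * _).
by apply: eq_bigr => m _; exact: knownk.
Qed.

Lemma hpoly_good L (pL : 'Hom('rV[K]_L, 'rV[K]_N)) :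
  hpoly (1 + r.+1) (fun y => good (pL y)).
Proof. by apply: hpolyM; [exact: hpoly_pcoord|exact: hpoly_pivots]. Qed.

Lemma grassmannian_neq0 x : X x -> x != 0.
Proof. by move=> [A rA <-]; rewrite -row_free_plucker. Qed.

Lemma good_neq0 (x : 'rV[K]_N) : good x != 0 -> x != 0.
Proof. by apply: contra_neq => ->; rewrite pcoord0 mul0r. Qed.

(** Pulled back along [plucker], the equation lives on the affine space of matrices, where
    [polyfun_dense] applies. Taking [pL] to be the identity serves the Grassmannian, and [Pi] its
    image. *)
Lemma grassmannian_dense L (pL : 'Hom('rV[K]_N, 'rV[K]_L)) d f :
  hpoly d f -> (forall x, X x -> good x != 0 -> f (pL x) = 0) ->
  forall A, f (pL (plucker A)) = 0.
Proof.
move=> hf fX; have [A1 nzA1] := pivots_generic K w0inj w0k.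
have lP c A B : polyfun (fun t => plucker (A + t *: B) ord0 c).
  apply: (@polyfun_ext _ (fun t => minor (A + t *: B) (enumw (enum_val c)))) => [t|].
    by rewrite pluckerE.
  apply: polyfun_det => i j.
  apply: (@polyfun_ext _ (fun t =>
      A i (enumw (enum_val c) j) + t * B i (enumw (enum_val c) j))) => [t|].
    by rewrite !mxE.
  apply: polyfunD; first exact: polyfun_cst.
  by apply: polyfunM; [exact: polyfun_id|exact: polyfun_cst].
apply: (polyfun_dense (c := fun A => good (plucker A)) _ _ nzA1).
- move=> A B; apply: (polyfun_hpoly hf) => c.
  by apply: (polyfun_hpoly (hpoly_linear pL c)) => i; exact: lP.
- move=> A B.
  apply: (@polyfun_ext _ (fun t =>
      good ((\1%VF : 'End('rV[K]_N)) (plucker (A + t *: B))))) => [t|].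
    by rewrite id_lfunE.
  by apply: (polyfun_hpoly (hpoly_good \1%VF)) => c; exact: lP.
- move=> A nzA; apply: fX => //; exists A => //=.
  by rewrite row_free_plucker good_neq0.
Qed.

Lemma dense_open_grassmannian :
  dense_open_in X (X `\` [set x | x != 0 /\ good x = 0]).
Proof.
split.
  exists [set x | x != 0 /\ good x = 0] => //.
  apply: (@zariski_closed_hpoly _ _ (1 + r.+1)).
  by apply: hpoly_ext (hpoly_good \1%VF) => x; rewrite id_lfunE.
move=> x Xx Z [S hS ->] sub; split; first exact: grassmannian_neq0.
move=> F SF; have [d hF] := hS F SF.
have hf : hpoly d (fun v => evalp v F) by exists F.
have [A rA <-] := Xx.
rewrite -[plucker A]id_lfunE.
apply: (grassmannian_dense (pL := \1%VF) hf) => {}x {}Xx nzx.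
rewrite id_lfunE; apply: (sub x _).2 => //; split=> // -[_ gx].
by rewrite gx eqxx in nzx.
Qed.

Lemma image_closure_neq0 y : Y y -> y != 0.
Proof.
by move=> Yy; apply: (Yy _ (zariski_closed_neq0 _ _)) => z [].
Qed.

(** The zero set of [f] is closed, so it contains the closure as soon as it contains the image;
    [grassmannian_dense] reduces this to good points. *)
Lemma image_closure_ind d f :
  hpoly d f -> (forall x, X x -> good x != 0 -> f (Pi x) = 0) ->
  forall y, Y y -> f y = 0.
Proof.
move=> hf fX y Yy; apply: (Yy _ (zariski_closed_hpoly hf) _).2.
move=> z [nz [x [A rA <-] zE]]; split=> //; rewrite zE.
exact: (grassmannian_dense hf fX).
Qed.

Lemma Pi_good (x : 'rV[K]_N) : good x != 0 -> Pi x != 0.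
Proof.
by apply: contra_neq => Px; rewrite -good_known Px linear0 pcoord0 mul0r.
Qed.

Lemma Pi_image x : X x -> good x != 0 -> Y (Pi x).
Proof.
move=> Xx gx Z _ sub; apply: sub; split; first exact: Pi_good.
by exists x.
Qed.

Lemma dense_open_image :
  dense_open_in Y (Y `\` [set y | y != 0 /\ good (rho y) = 0]).
Proof.
split.
  exists [set y | y != 0 /\ good (rho y) = 0] => //.
  exact: zariski_closed_hpoly (hpoly_good rho).
move=> y Yy Z [S hS ->] sub; split; first exact: image_closure_neq0.
move=> F SF; have [d hF] := hS F SF.
have hf : hpoly d (fun v => evalp v F) by exists F.
apply: (image_closure_ind hf) Yy => x Xx gx.
apply: (sub (Pi x) _).2 => //; split; first exact: Pi_image.
by move=> [_]; rewrite good_known => gx0; rewrite gx0 eqxx in gx.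
Qed.

Lemma diff_good x : (X `\` [set x | x != 0 /\ good x = 0]) x -> good x != 0.
Proof.
move=> [Xx /= gx]; apply/eqP => gx0; apply: gx; split=> //.
exact: grassmannian_neq0.
Qed.

Lemma inverse_grassmannian y : good (rho y) != 0 -> X (inverse y).
Proof.
move=> gy; exists (rec_mx w0 k sel (rho y)) => //=.
by apply: (@minor_row_free _ _ _ _ w0); rewrite minor_rec_mx // expf_neq0.
Qed.

Local Notation factor x := (pivots w0 k x ^+ r.+1 * pcoord w0 x ^+ r).

Lemma factor_neq0 (x : 'rV[K]_N) : good x != 0 -> factor x != 0.
Proof. by rewrite mulf_eq0 negb_or => /andP[p0 p]; rewrite mulf_neq0 ?expf_neq0. Qed.

Lemma inverse_Pi x : X x -> good x != 0 -> inverse (Pi x) = factor x *: x.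
Proof.
move=> [A _ <-] gx; rewrite rec_mx_known plucker_rec_mx //.
by apply: contra_neq gx => ->; rewrite mul0r.
Qed.

(** Both sides are homogeneous in [y] of the same degree, so the equation is a closed condition and
    need only be checked at [Pi x] for good [x], where [inverse_Pi] gives it. *)
Lemma Pi_inverse y : Y y -> Pi (inverse y) = factor (rho y) *: y.
Proof.
move=> Yy; apply/rowP => c; apply/eqP; rewrite -subr_eq0; apply/eqP.
have hf : hpoly (r.+1 * r.+2)
    (fun y => Pi (inverse y) ord0 c - (factor (rho y) *: y) ord0 c).
  apply: (@hpoly_ext _ _ _ (fun y =>
      \sum_j Pi (delta_mx ord0 j) ord0 c * inverse y ord0 j +
      (-1) * (factor (rho y) * y ord0 c))) => [z|].
    rewrite mxE mulN1r; congr (_ - _).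
    rewrite [in RHS](row_sum_delta (inverse z)) linear_sum summxE.
    by apply: eq_bigr => j _; rewrite linearZ [RHS]mxE mulrC.
  apply: hpolyD.
    by apply: hpoly_sum => j; exact/hpolyZ/hpoly_plucker_rec_mx.
  (* The degrees are [r.+1 * r.+1] for the power of [pivots], [r] for the power of the minor [w0],
     and 1 for the coordinate of [y]. *)
  apply: hpolyZ; rewrite (_ : (r.+1 * r.+2)%N = r.+1 * r.+1 + r * 1 + 1)%N; last first.
    by rewrite muln1 -addnA addn1 [LHS]mulnS [LHS]addnC.
  apply: hpolyM; last exact: hpoly_coord.
  by apply: hpolyM; apply: hpolyX; [exact: hpoly_pivots|exact: hpoly_pcoord].
apply: (image_closure_ind hf) Yy => x Xx gx.
by rewrite inverse_Pi // linearZ pivots_known known0 subrr.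
Qed.

Lemma birational_of_known : birational_map X Y Pi.
Proof.
have hPi : homogeneous_map Pi by apply: homogeneous_mapP => c; exact: hpoly_linear.
have goodY y : (Y `\` [set y | y != 0 /\ good (rho y) = 0]) y ->
    good (rho y) != 0.
  move=> [Yy gy]; apply/eqP => gy0; apply: gy; split=> //.
  exact: image_closure_neq0.
split.
  split=> //; exists (X `\` [set x | x != 0 /\ good x = 0]).
    exact: dense_open_grassmannian.
  move=> x Ux; have Xx := Ux.1; have gx := diff_good Ux.
  by split; [exact: Pi_good|exact: Pi_image].
exists (fun y => inverse y); split.
- split; first by apply: homogeneous_mapP => c; exact: hpoly_plucker_rec_mx.
  exists (Y `\` [set y | y != 0 /\ good (rho y) = 0]); first exact: dense_open_image.
  move=> y /goodY gy; have Xy := inverse_grassmannian gy; split=> //.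
  exact: grassmannian_neq0.
- exists (X `\` [set x | x != 0 /\ good x = 0]); first exact: dense_open_grassmannian.
  move=> x Ux; have Xx := Ux.1; have gx := diff_good Ux.
  split; last by exists (factor x); [exact: factor_neq0|exact: inverse_Pi].
  by apply/grassmannian_neq0/inverse_grassmannian; rewrite good_known.
- exists (Y `\` [set y | y != 0 /\ good (rho y) = 0]); first exact: dense_open_image.
  move=> y Uy; have gy := goodY y Uy; have Yy := Uy.1.
  rewrite /same_point /= Pi_inverse //; split; last first.
    by exists (factor (rho y)) => //; exact: factor_neq0.
  by rewrite scaler_eq0 negb_or factor_neq0 // image_closure_neq0.
Qed.

End Birational.

(** * Capacities of the blocks *)

Section Capacity.
Local Open Scope nat_scope.
Variables (T : finType) (l : nat) (B : 'I_l -> {set T}) (cap : 'I_l -> nat).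
Implicit Types (G J : {set T}).

Definition within_cap J := [forall b, #|J :&: B b| <= cap b].

Lemma within_capS J G : J \subset G -> within_cap G -> within_cap J.
Proof.
move=> sJG /forallP capG; apply/forallP => b; apply: leq_trans (capG b).
exact/subset_leq_card/finset.setSI.
Qed.

(** The only block that [j] can overflow is its own, which [G] then fills to capacity. Any [g] of
    [G] in that block makes room for [j], and [k] lies outside it because [k |: G] respects the
    capacity. *)
Lemma within_cap_exchange G k j :
  (forall b b' x, x \in B b -> x \in B b' -> b = b') ->
  (forall b, 0 < cap b) -> k \notin G -> within_cap (k |: G) ->
  ~~ within_cap (j |: G) ->
  exists2 g, g \in G & within_cap (j |: (k |: (G :\ g))).
Proof.
move=> disj cap_gt0 kG capkG /forallPn[b]; rewrite -ltnNge => big.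
have capG : #|G :&: B b| <= cap b.
  by have /forallP := within_capS (finset.subsetUr [set k] G) capkG; apply.
have jB : j \in B b.
  apply: contraTT big => jB; rewrite -leqNgt (leq_trans _ capG) //.
  apply: subset_leq_card; apply/fintype.subsetP => x.
  rewrite !inE => /andP[/orP[/eqP->|xG] xB]; first by rewrite xB in jB.
  by rewrite xG.
have full : cap b <= #|G :&: B b|.
  rewrite -ltnS (leq_trans big) // finset.setIUl (leq_trans (leq_card_setU _ _)) //.
  rewrite -add1n leq_add2r (leq_trans (subset_leq_card (finset.subsetIl _ _))) //.
  by rewrite cards1.
have [ g ] : exists g, g \in G :&: B b.
  by apply/finset.set0Pn; rewrite -card_gt0 (leq_trans (cap_gt0 b)).
rewrite inE => /andP[gG gB].
have kB : k \notin B b.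
  apply/negP => kB; have /forallP/(_ b) := capkG.
  rewrite leqNgt => /negP; apply; apply: leq_ltn_trans full _.
  apply: proper_card; apply/fintype.properP; split.
    exact/finset.setSI/finset.subsetUr.
  by exists k; rewrite !inE ?eqxx ?kB // (negPf kG).
exists g => //; apply/forallP => b'; have [eb|nb] := eqVneq b' b.
  rewrite eb; apply: leq_trans capG.
  rewrite (cardsD1 g (G :&: B b)) inE gG gB /=.
  have : (j |: (k |: (G :\ g))) :&: B b \subset j |: ((G :&: B b) :\ g).
    apply/fintype.subsetP => x; rewrite !inE => /andP[+ xB].
    case/or3P => [->//|/eqP xk|/andP[-> ->]]; last by rewrite xB orbT.
    by rewrite xk (negPf kB) in xB.
  move=> /subset_leq_card /leq_trans; apply.
  by rewrite (leq_trans (leq_card_setU _ _)) // cards1.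
have /forallP/(_ b') := capkG; apply: leq_trans; apply: subset_leq_card.
apply/fintype.subsetP => x; rewrite !inE => /andP[+ xB].
case/or3P => [/eqP xj|->//|/andP[_ ->]]; last by rewrite xB orbT.
by rewrite xj in xB; rewrite (disj _ _ _ xB jB) eqxx in nb.
Qed.

(** From each [B b] discard all but [cap b] elements; what survives in [T] respects every capacity
    and has at least [m] elements. *)
Lemma within_cap_exists m : m + \sum_b (#|B b| - cap b) <= #|T| ->
  exists2 G, within_cap G & #|G| = m.
Proof.
move=> le_m; pose D b := [set x in drop (cap b) (enum (B b))].
have cardD b : #|D b| = #|B b| - cap b.
  by rewrite cardsE (card_uniqP _) ?drop_uniq ?enum_uniq // size_drop -cardE.
pose E := ~: \bigcup_b D b.
have sumD : #|\bigcup_b D b| <= \sum_b (#|B b| - cap b).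
  under [leqRHS]eq_bigr => b _ do rewrite -cardD.
  elim/big_rec2: _ => [|b c J _ le_J]; first by rewrite cards0.
  by rewrite (leq_trans (leq_card_setU _ _)) // leq_add2l.
have mE : m <= #|E|.
  rewrite cardsCs finset.setCK leq_subRL ?(leq_trans _ le_m) ?leq_addl //.
    by rewrite addnC leq_add2l.
  by rewrite (leq_trans sumD) // leq_addl.
exists [set x in take m (enum E)]; last first.
  rewrite cardsE (card_uniqP _) ?take_uniq ?enum_uniq // size_take -cardE.
  by case: ltngtP mE.
apply: (@within_capS _ E).
  by apply/fintype.subsetP => x; rewrite inE => /mem_take; rewrite mem_enum.
apply/forallP => b.
have : E :&: B b \subset B b :\: D b.
  apply/fintype.subsetP => x; rewrite !inE => /andP[xE ->]; rewrite andbT.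
  by apply: contra xE => xD; apply/finset.bigcupP; exists b => //; rewrite inE.
move/subset_leq_card/leq_trans; apply.
have DB : D b \subset B b.
  by apply/fintype.subsetP => x; rewrite inE => /mem_drop; rewrite mem_enum.
by rewrite cardsD (finset.setIidPr DB) cardD leq_subLR addnC -leq_subLR.
Qed.

End Capacity.

Section Blocks.
Local Open Scope nat_scope.
Variables (r n : nat).

Lemma card_block j : #|block r n j| <= r.+1.
Proof.
have : block r n j \subset [set inord (r.+1 * j + i) | i : 'I_r.+1].
  apply/fintype.subsetP => x; rewrite inE mulnS addnC => /andP[jx xj].
  have ltx : x - r.+1 * j < r.+1 by rewrite ltn_subLR.
  by apply/imsetP; exists (Ordinal ltx) => //=; rewrite subnKC // inord_val.
move/subset_leq_card/leq_trans; apply.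
by rewrite (leq_trans (leq_imset_card _ _)) // card_ord.
Qed.

Lemma block_disjoint j j' x : x \in block r n j -> x \in block r n j' -> j = j'.
Proof.
have E i : x \in block r n i -> i = x %/ r.+1.
  rewrite inE mulnC [_ * i.+1]mulnC -leq_divRL // -ltn_divLR // ltnS => le.
  by apply/eqP; rewrite eqn_leq.
by move=> /E -> /E ->.
Qed.

End Blocks.

(** A block has at most [r.+1] columns, of which [r - s j] may be used, so discarding [(s j).+1] per
    block is enough; the numerical hypothesis leaves [r.+2] columns. *)
Theorem osculating_projection_birational (K : numFieldType) (r n l : nat)
    (s : 'I_l -> nat) (T : 'I_l -> {vspace 'rV[K]_(plucker_dim r n)})
    (M : nat) (Pi : 'Hom('rV[K]_(plucker_dim r n), 'rV[K]_M)) :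
  (forall j, (s j < r)%N) -> (r.+2 + \sum_j (s j).+1 <= n.+1)%N ->
  (forall j : 'I_l, osculating_space (grassmannian K r n)
     (e_point K r (block r n j)) (s j) (T j)) ->
  lker Pi = (\sum_j T j)%VS ->
  birational_map (grassmannian K r n) (image_closure (grassmannian K r n) Pi) Pi.
Proof.
move=> s_lt sum_s oscT kerPi.
(* A set [J] of [r.+1] columns meets block [j] in at most [r - s j] elements exactly when more than
   [s j] of its elements lie outside the block, as [osculating_coord0] requires. *)
pose cap j := (r - s j)%N; pose B (j : 'I_l) := block r n j.
have [G capG cardG] : exists2 G, within_cap B cap G & #|G| = r.+2.
  apply: within_cap_exists; rewrite card_ord; apply: leq_trans sum_s.
  rewrite leq_add2l; apply: leq_sum => j _.
  rewrite leq_subLR (leq_trans (card_block _ _ _)) // addnS ltnS subnK //.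
  exact: ltnW.
have [ k kG ] : exists k, k \in G.
  by apply/finset.set0Pn; rewrite -card_gt0 cardG.
pose G0 := G :\ k.
have cG0 : #|G0| = r.+1 by move: cardG; rewrite (cardsD1 k) kG => -[].
have kG0 : k \notin G0 by rewrite !inE eqxx.
have GE : k |: G0 = G by rewrite finset.setD1K.
pose w0 : 'I_r.+1 -> 'I_n.+1 := enumw G0.
have w0G i : w0 i \in G0 by exact: enumw_mem.
(* A generalized inverse: [Pi (rho (Pi x)) = Pi x], so [rho (Pi x) - x] lies in the kernel, the sum
   of the [T j]. *)
pose rho := (Pi^-1)%VF.
have agree x (c : 'I_(plucker_dim r n)) : within_cap B cap (enum_val c) ->
    rho (Pi x) ord0 c = x ord0 c.
  move=> /forallP capc; apply/eqP; rewrite -subr_eq0.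
  have : rho (Pi x) - x \in (\sum_j T j)%VS.
    by rewrite -kerPi memv_ker linearB /= limg_lfunVK ?subrr // memv_img ?memvf.
  case/memv_sumP => v vT dE.
  have -> : rho (Pi x) ord0 c - x ord0 c = (rho (Pi x) - x) ord0 c by rewrite !mxE.
  rewrite dE summxE big1 // => j _; apply: (osculating_coord0 (oscT j)); last exact: vT.
  rewrite cardsD plucker_indexP; have := capc j; rewrite /cap /B => cj.
  rewrite ltn_subRL; apply: leq_ltn_trans (leq_add cj (leqnn _)) _.
  by rewrite subnK // ltnW.
have knownP w (J : {set 'I_n.+1}) : (forall i, w i \in J) -> within_cap B cap J ->
    known Pi rho w.
  move=> wJ capJ x; apply: eq_pcoord => c ec; apply: agree; rewrite ec.
  apply: within_capS capJ; apply/fintype.subsetP => _ /imsetP[i _ ->]; exact: wJ.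
have capG0 : within_cap B cap G0 by apply: within_capS capG; exact: finset.subsetDl.
(* The first [None] marks the columns read off directly. In the other branch [pick] never fails, by
   [within_cap_exchange]. *)
pose sel j := if within_cap B cap (j |: G0) then None
  else [pick i | within_cap B cap (j |: (k |: (G0 :\ w0 i)))].
apply: (@birational_of_known _ _ _ _ Pi rho w0 k sel).
- exact: enumw_inj.
- by move=> m; apply: contraNneq kG0 => <-.
- by move=> m; rewrite /sel (finset.setUidPr _) ?capG0 // finset.sub1set w0G.
- exact: (knownP _ _ w0G).
- move=> m; apply: (knownP _ G) => // i; rewrite /setw -GE finset.in_setU1.
  by case: (i =P m) => _; rewrite ?eqxx // w0G orbT.
- move=> j i; rewrite /sel; case: ifPn => [okj|nokj].
    apply: (knownP _ _ _ okj) => i'; rewrite /setw finset.in_setU1.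
    by case: (i' =P i) => _; rewrite ?eqxx // w0G orbT.
  case: pickP => [i0 ok0|none].
    apply: (knownP _ _ _ ok0) => i'; rewrite /setw.
    case: (i' =P i) => [_|_]; first by rewrite !inE eqxx.
    case: (i' =P i0) => [_|/eqP ne]; first by rewrite !inE eqxx orbT.
    rewrite !inE (inj_eq (enumw_inj cG0)) ne.
    by have := w0G i'; rewrite !inE => ->; rewrite !orbT.
  have [|||g gG] := @within_cap_exchange _ _ B cap G0 k j _ _ kG0 _ nokj.
  + by move=> b b' x xb xb'; apply/val_inj/(block_disjoint xb xb').
  + by move=> b; rewrite subn_gt0.
  + by rewrite GE.
  have : g \in [set w0 i | i : 'I_r.+1] by rewrite imset_enumw.
  by move=> /imsetP[i0 _ ->]; rewrite none.
Qed.

Theorem proposition3p4 (R : realType) (r n : nat) (hr : (2 <= r)%N)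
    (hn : (2 * r + 1 <= n)%N) (l : nat) (s : 'I_l -> nat)
    (hs : forall j, (s j <= r - 1)%N)
    (hl : (0 < l <=
           minn ((n + 1) %/ (r + 1)) (n - r - 1 - \sum_(i < l) s i))%N)
    (T : 'I_l -> {vspace 'rV[R[i]]_(plucker_dim r n)})
    (hT : forall j : 'I_l,
        osculating_space (grassmannian R[i] r n)
          (e_point R[i] r (block r n j)) (s j) (T j))
    (M : nat) (Pi : 'Hom('rV[R[i]]_(plucker_dim r n), 'rV[R[i]]_M))
    (hPi : linear_projection (\sum_(j < l) T j)%VS Pi) :
  birational_map (grassmannian R[i] r n)
    (image_closure (grassmannian R[i] r n) Pi) Pi.
Proof.
apply: (osculating_projection_birational _ _ hT hPi.1).
  by move=> j; rewrite -[ltnRHS](subnK (ltnW hr)) addn1 ltnS.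
case/andP: hl => l_gt0; rewrite leq_min => /andP[_ hl].
under eq_bigr do rewrite -addn1.
rewrite big_split /= sum_nat_const card_ord muln1.
(* Positivity of [l] makes the truncated difference [n - r - 1 - S] positive, hence a genuine
   one. *)
have {}l_gt0 := leq_trans l_gt0 hl; move: hl l_gt0.
move: (\sum_(i < l) s i)%N => S hl l_gt0; lia.
Qed.
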